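(* There exists a bounded linear operator on a Hilbert space which is not orbit-reflexive.
   Context: For a bounded operator $T$ on a Banach space $X$ and $x\in X$, $\mathcal{O}rb(x,T)=\{T^{n}x : n\geq 0\}$. $T\in\mathcal{B}(X)$ is orbit-reflexive if whenever $A\in\mathcal{B}(X)$ is such that $Ax$ belongs to the closure of $\mathcal{O}rb(x,T)$ for every $x\in X$, then $A$ belongs to the closure of the set $\{T^{n} : n\geq 0\}$ for the Strong Operator Topology. *)

(* Defs.v *)
From HB Require Import structures.
From mathcomp Require Import all_boot all_order all_algebra sesquilinear.
From mathcomp Require Import complex.
From mathcomp Require Import all_classical all_reals all_analysis.

Set Implicit Arguments.
Unset Strict Implicit.
Unset Printing Implicit Defensive.

Import Order.TTheory GRing.Theory Num.Theory.
Import numFieldNormedType.Exports.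

Local Open Scope classical_set_scope.
Local Open Scope ring_scope.

Definition bounded_operators (K : numFieldType) (X : normedModType K) :
    set {ptws X -> X} :=
  [set T : X -> X | linear T /\ exists M : K, forall x, `|T x| <= M * `|x|].
Arguments bounded_operators {K} X _.

(* [set_type] carries the topology induced by the inclusion into
   [{ptws X -> X}], i.e. by the topology of pointwise norm convergence: this is
   the strong operator topology on B(X). *)
Definition boundedOp (K : numFieldType) (X : normedModType K) : Type :=
  set_type (bounded_operators X).

HB.instance Definition _ (K : numFieldType) (X : normedModType K) :=
  Topological.on (boundedOp X).

Definition op_fun (K : numFieldType) (X : normedModType K)
  (T : boundedOp X) : X -> X := set_val T.
Coercion op_fun : boundedOp >-> Funclass.

Definition Orb (K : numFieldType) (X : normedModType K) (x : X)
  (T : boundedOp X) : set X := [set iter n T x | n in [set: nat]].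

Definition powers (K : numFieldType) (X : normedModType K)
    (T : boundedOp X) : set (boundedOp X) :=
  [set S | exists n : nat, forall x, S x = iter n T x].

Definition orbit_reflexive (K : numFieldType) (X : completeNormedModType K)
    (T : boundedOp X) : Prop :=
  forall A : boundedOp X,
    (forall x : X, closure (Orb x T) (A x)) -> closure (powers T) A.

(* An inner product (linear in the first variable, conjugate-symmetric and
   positive definite) inducing the norm of X; with the completeness of X, this
   makes X a complex Hilbert space. *)
Definition is_hilbert (R : realType) (X : completeNormedModType R[i]) : Prop :=
  exists dot : {dot X for (@Num.conj R[i])},
    forall x : X, `|x| ^+ 2 = dot x x.

(* Main.v *)
Require Import Defs.
From HB Require Import structures.
From mathcomp Require Import all_boot all_order all_algebra.
From mathcomp Require Import complex sesquilinear.
From mathcomp Require Import all_classical all_reals all_analysis.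
From mathcomp Require Import ring lra zify.

Set Implicit Arguments.
Unset Strict Implicit.
Unset Printing Implicit Defensive.

Import Order.TTheory GRing.Theory Num.Theory.
Import numFieldNormedType.Exports.

Local Open Scope classical_set_scope.
Local Open Scope ring_scope.
Local Open Scope complex_scope.

(** The space is the complex l2 on nat, with basis e_0, e_1, ....  Put
    m_0 = 1 and m_j = 2 ^ j * m_(j-1) ([period]), choose linear forms
    w_j (s, t) = a_j s + b_j t on C^2 with |a_j|^2 + |b_j|^2 = 1 that come,
    infinitely often, arbitrarily close to vanishing at any given vector, and
    let T erase coordinate 0, preserve coordinates 1 and 2, and act on the later
    ones by

      (T x)_j = lambda_j x_j + w_j (x_1, x_2) / m_j,   j >= 3,

    where lambda_j is a primitive root of unity of order m_(j+1).  Then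

      (T^n x)_j = lambda_j^n x_j
                  + (1 + lambda_j + ... + lambda_j^(n-1)) w_j (x_1, x_2) / m_j.

    The operator A that erases coordinate 0 witnesses the failure of
    orbit-reflexivity.

    Each A x is in the closure of the orbit of x.  Take n = m_k.  For
    3 <= j < k the order m_(j+1) divides n, so coordinate j of T^n x is x_j.
    For j > k the geometric sum is at most m_k in modulus and m_k / m_j <=
    2 ^ -j, so these coordinates contribute only the tail of a convergent
    series.  The coordinate j = k contributes w_k (x_1, x_2) up to a factor of
    modulus at most 1, in addition to a tail term, and k can be chosen large
    with w_k (x_1, x_2) as small as desired ([drop0_in_orbit_closure]).

    No power of T is close to A at e_0, e_1 and e_2 simultaneously.  The
    vector e_0 excludes n = 0.  For n > 0 some j has m_j <= 64 n and
    8 n <= m_(j+1) ([period_window]); the powers of lambda_j up to n then stay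
    in a sector of opening pi / 4, so the geometric sum has modulus at least
    n / 2 and hence at least m_j / 128 ([sqmod_geom_ge]).  As one of a_j, b_j
    is not small, T^n moves e_1 or e_2 by a fixed amount ([drop0_gap]).

    In short, a single linear form can be made to vanish at one vector of the
    plane spanned by e_1 and e_2, but never at two independent ones. *)

(** * The space of square-summable complex sequences *)

Section SquareSummable.
Variable R : realType.
Implicit Types (z w : R[i]) (f g h : nat -> R[i]).

Definition sqmod z : R := complex.Re z ^+ 2 + complex.Im z ^+ 2.

Lemma sqmod_ge0 z : 0 <= sqmod z.
Proof. by rewrite addr_ge0 ?sqr_ge0. Qed.

Lemma sqmodE z : (sqmod z)%:C = `|z| ^+ 2.
Proof. exact: add_Re2_Im2. Qed.

Lemma sqmod0 : sqmod 0 = 0.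
Proof. by rewrite /sqmod /= expr0n addr0. Qed.

Lemma sqmod1 : sqmod 1 = 1.
Proof. by rewrite /sqmod /= expr1n expr0n addr0. Qed.

Lemma sqmod_eq0 z : sqmod z = 0 -> z = 0.
Proof.
move=> z0; have := sqmodE z; rewrite z0 => /esym/eqP.
by rewrite sqrf_eq0 normr_eq0 => /eqP.
Qed.

Lemma sqmodM z w : sqmod (z * w) = sqmod z * sqmod w.
Proof. by case: z w => [a b] [c d]; rewrite /sqmod /=; ring. Qed.

Lemma sqmodX z n : sqmod (z ^+ n) = sqmod z ^+ n.
Proof.
elim: n => [|n IHn]; last by rewrite !exprS sqmodM IHn.
by rewrite !expr0 sqmod1.
Qed.

Lemma sqmodN z : sqmod (- z) = sqmod z.
Proof. by rewrite /sqmod !raddfN/= !sqrrN. Qed.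

Lemma sqmodR (r : R) : sqmod r%:C = r ^+ 2.
Proof. by rewrite /sqmod/= expr0n addr0. Qed.

Lemma sqmod_invn n : sqmod ((n%:R : R[i])^-1) = n%:R^-1 ^+ 2.
Proof.
by apply: complexI; rewrite sqmodE normfV normr_nat [RHS]rmorphXn fmorphV rmorph_nat.
Qed.

(** The weight t is left free because optimizing over it afterwards turns this
    termwise bound into the triangle inequality of l2, without going through
    Cauchy-Schwarz. *)
Lemma sqmodD_le (t : R) z w : 0 < t ->
  sqmod (z + w) <= (1 + t) * sqmod z + (1 + t^-1) * sqmod w.
Proof.
move=> t0; case: z w => [a b] [c d]; rewrite /sqmod /= -subr_ge0.
have -> : (1 + t) * (a ^+ 2 + b ^+ 2) + (1 + t^-1) * (c ^+ 2 + d ^+ 2) -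
   ((a + c) ^+ 2 + (b + d) ^+ 2) = t^-1 * ((t * a - c) ^+ 2 + (t * b - d) ^+ 2).
  by field; rewrite gt_eqF.
by rewrite mulr_ge0 ?invr_ge0 ?(ltW t0)// addr_ge0 ?sqr_ge0.
Qed.

Lemma sqmodD_le2 z w : sqmod (z + w) <= 2 * sqmod z + 2 * sqmod w.
Proof. by have := @sqmodD_le 1 z w ltr01; rewrite invr1. Qed.

Definition psum f n : R := \sum_(k < n) sqmod (f k).

Definition square_summable : {pred nat -> R[i]} :=
  fun f => `[< exists M : R, forall n, psum f n <= M >].

Lemma square_summableP f :
  reflect (exists M : R, forall n, psum f n <= M) (f \in square_summable).
Proof. exact: asboolP. Qed.

Lemma square_summable_submod : submod_closed square_summable.
Proof.
split=> [|a f g /square_summableP[M fM] /square_summableP[N gN]].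
  apply/square_summableP; exists 0 => n.
  by rewrite /psum big1// => k _; rewrite sqmod0.
apply/square_summableP; exists (2 * (sqmod a * M) + 2 * N) => n.
apply: (@le_trans _ _ (2 * (sqmod a * psum f n) + 2 * psum g n)).
  rewrite /psum !mulr_sumr -big_split/=; apply: ler_sum => k _.
  by apply: le_trans (sqmodD_le2 _ _) _; rewrite /GRing.scale/= sqmodM.
by apply: lerD; rewrite ler_pM2l// ?ler_wpM2l// sqmod_ge0.
Qed.

HB.instance Definition _ :=
  GRing.isSubmodClosed.Build R[i] (nat -> R[i]) square_summable square_summable_submod.

Record ell2 := Ell2 { entry : nat -> R[i]; _ : entry \in square_summable }.

HB.instance Definition _ := [isSub for entry].
HB.instance Definition _ := [Choice of ell2 by <:].
HB.instance Definition _ := [SubChoice_isSubLmodule of ell2 by <:].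

Implicit Types x y : ell2.

Definition energy f : R := limn (psum f).

Lemma psum_nondecreasing f : nondecreasing_seq (psum f).
Proof.
apply/nondecreasing_seqP => n.
by rewrite /psum big_ord_recr/= lerDl sqmod_ge0.
Qed.

Lemma psum_cvg x : psum (entry x) @ \oo --> energy (entry x).
Proof.
have [M xM] := square_summableP _ (valP x).
apply: nondecreasing_is_cvgn; first exact: psum_nondecreasing.
by exists M => _ [n _ <-]; exact: xM.
Qed.

Lemma psum_le_energy x n : psum (entry x) n <= energy (entry x).
Proof.
apply: nondecreasing_cvgn_le; first exact: psum_nondecreasing.
exact: psum_cvg.
Qed.

Lemma energy_le x M : (forall n, psum (entry x) n <= M) -> energy (entry x) <= M.
Proof.
move=> xM; apply: limr_le; first exact: psum_cvg.
by apply: nearW.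
Qed.

Lemma sqmod_entry_le x k : sqmod (entry x k) <= energy (entry x).
Proof.
apply: le_trans (psum_le_energy x k.+1).
by rewrite /psum big_ord_recr/= lerDr sumr_ge0// => i _; exact: sqmod_ge0.
Qed.

Lemma energy_ge0 x : 0 <= energy (entry x).
Proof. exact: le_trans (sqmod_ge0 _) (sqmod_entry_le x 0). Qed.

Definition enorm x : R := Num.sqrt (energy (entry x)).

Lemma enorm_ge0 x : 0 <= enorm x.
Proof. exact: sqrtr_ge0. Qed.

Lemma enorm_sqr x : enorm x ^+ 2 = energy (entry x).
Proof. by rewrite sqr_sqrtr// energy_ge0. Qed.

Lemma enorm_leP x M : 0 <= M ->
  (enorm x <= M) <-> (forall n, psum (entry x) n <= M ^+ 2).
Proof.
move=> M0; split=> [xM n|xM].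
  by rewrite (le_trans (psum_le_energy _ _))// -enorm_sqr lerXn2r ?nnegrE ?enorm_ge0.
by rewrite -(@ler_pXn2r _ 2) ?nnegrE ?enorm_ge0// enorm_sqr energy_le.
Qed.

Lemma entryD x y k : entry (x + y) k = entry x k + entry y k.
Proof. by []. Qed.

Lemma entryN x k : entry (- x) k = - entry x k.
Proof. by []. Qed.

Lemma entryZ (a : R[i]) x k : entry (a *: x) k = a * entry x k.
Proof. by []. Qed.

Lemma entry0 k : entry 0 k = 0.
Proof. by []. Qed.

Lemma ell2_eq x y : entry x =1 entry y -> x = y.
Proof. by move=> xy; apply: val_inj; apply/funext. Qed.

Lemma enorm0_eq0 x : enorm x = 0 -> x = 0.
Proof.
move=> x0; apply: ell2_eq => k; rewrite entry0; apply: sqmod_eq0.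
apply/eqP; rewrite eq_le sqmod_ge0 andbT (le_trans (sqmod_entry_le _ _))//.
by rewrite -enorm_sqr x0 expr0n.
Qed.

(** Summing [sqmodD_le] with t the ratio of the two norms makes the right-hand
    side equal to the square of the sum of the norms. *)
Lemma enormD x y : enorm (x + y) <= enorm x + enorm y.
Proof.
have := enorm_ge0 x; rewrite le_eqVlt => /predU1P[/esym x0|x0].
  by rewrite (enorm0_eq0 x0) add0r lerDr enorm_ge0.
have := enorm_ge0 y; rewrite le_eqVlt => /predU1P[/esym y0|y0].
  by rewrite (enorm0_eq0 y0) addr0 lerDl enorm_ge0.
apply/enorm_leP => [|n]; first by rewrite addr_ge0 ?ltW.
set t := enorm y / enorm x; have t0 : 0 < t by rewrite divr_gt0.
have -> : (enorm x + enorm y) ^+ 2 =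
    (1 + t) * enorm x ^+ 2 + (1 + t^-1) * enorm y ^+ 2.
  by rewrite /t; field; rewrite !gt_eqF.
apply: (@le_trans _ _ ((1 + t) * psum (entry x) n + (1 + t^-1) * psum (entry y) n)).
  rewrite /psum !mulr_sumr -big_split/=; apply: ler_sum => k _.
  exact: sqmodD_le.
rewrite !enorm_sqr.
by apply: lerD; rewrite ler_wpM2l ?psum_le_energy// addr_ge0// ?invr_ge0 ltW.
Qed.

Lemma psumZ (a : R[i]) x n : psum (entry (a *: x)) n = sqmod a * psum (entry x) n.
Proof.
by rewrite /psum mulr_sumr; apply: eq_bigr => k _; rewrite entryZ sqmodM.
Qed.

Lemma enormZ (a : R[i]) x : (enorm (a *: x))%:C = `|a| * (enorm x)%:C.
Proof.
rewrite /enorm (_ : energy _ = sqmod a * energy (entry x)); last first.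
  apply: cvg_lim => //; rewrite (funext (psumZ a x)).
  by apply: cvgMr; exact: psum_cvg.
by rewrite sqrtrM ?sqmod_ge0// rmorphM/= normc_def.
Qed.

Lemma enormDC x y :
  (enorm (x + y))%:C <= (enorm x)%:C + (enorm y)%:C :> R[i].
Proof. by rewrite -rmorphD lecR; exact: enormD. Qed.

Lemma enorm0C_eq0 x : (enorm x)%:C = 0 :> R[i] -> x = 0.
Proof. by move=> /complexI /enorm0_eq0. Qed.

HB.instance Definition _ :=
  Lmodule_isNormed.Build R[i] ell2 enormDC enormZ enorm0C_eq0.

Lemma ell2_normE x : `|x| = (enorm x)%:C.
Proof. by []. Qed.

Lemma pos_complexP (e : R[i]) : 0 < e -> exists2 r : R, 0 < r & e = r%:C.
Proof.
by case: e => a b; rewrite ltcE/= => /andP[/eqP -> a0]; exists a.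
Qed.

Lemma ell2_ballE x (r : R) y : ball x r%:C y <-> enorm (x - y) < r.
Proof. by rewrite -ball_normE /ball_/= ell2_normE ltcR. Qed.

Lemma Re_entry_le x k : `|complex.Re (entry x k)| <= enorm x.
Proof.
rewrite -sqrtr_sqr ler_wsqrtr// (le_trans _ (sqmod_entry_le x k))//.
by rewrite lerDl sqr_ge0.
Qed.

Lemma Im_entry_le x k : `|complex.Im (entry x k)| <= enorm x.
Proof.
rewrite -sqrtr_sqr ler_wsqrtr// (le_trans _ (sqmod_entry_le x k))//.
by rewrite lerDr sqr_ge0.
Qed.

Definition delta (i j : nat) : R[i] := (i == j)%:R.

Lemma delta_summable i : delta i \in square_summable.
Proof.
apply/square_summableP; exists 1 => n.
have -> : psum (delta i) n = (i < n)%:R.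
  elim: n => [|n IH]; first by rewrite /psum big_ord0.
  rewrite /psum big_ord_recr/= -/(psum _ _) IH ltnS /delta.
  by case: ltngtP => _ /=; rewrite /sqmod /= ?expr1n !expr0n ?addr0 ?add0r.
by rewrite lern1 leq_b1.
Qed.

Definition unit_vec i := Ell2 (delta_summable i).
End SquareSummable.

(** * Completeness *)

Section Complete.
Variable R : realType.
Local Notation H := (ell2 R).

(** The real and imaginary parts of an entry are 1-Lipschitz additive maps, so
    they carry a Cauchy filter to a Cauchy filter of reals.  Here p stands for
    either of them. *)
Lemma entry_cvg (F : set_system H) (p : R[i] -> R) k :
    (forall z w, p (z - w) = p z - p w) ->
    (forall x : H, `|p (entry x k)| <= enorm x) ->
  ProperFilter F -> cauchy F -> cvg ((fun x => p (entry x k)) @ F).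
Proof.
move=> pB pN FF /cauchy_ballP Fc; apply: cauchy_cvg; apply/cauchy_ballP => e e0.
have eC0 : 0 < e%:C :> R[i] by rewrite ltcR.
have [[A B] [/= FA FB] AB] := Fc _ eC0.
exists ([set p (entry x k) | x in A], [set p (entry x k) | x in B]).
  by split; [apply: filterS FA|apply: filterS FB] => x; exists x.
move=> [_ _] /= [[x Ax <-] [y By <-]].
have /ell2_ballE xye := AB (x, y) (conj Ax By).
rewrite -ball_normE /ball_/= -pB -[_ - _]/(entry (x - y) k).
exact: le_lt_trans (pN _) xye.
Qed.

(** The limit l is taken entry by entry.  A ball of F centred at x controls
    every partial sum of |x_k - l_k|^2, because such a sum involves finitely many
    entries and passes to the limit along F; this gives both that l is
    square-summable and that F converges to l in norm. *)
Lemma ell2_complete (F : set_system H) :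
  ProperFilter F -> cauchy F -> cvg F.
Proof.
move=> FF Fc.
have rc k : cvg ((fun x => complex.Re (entry x k)) @ F).
  by apply: entry_cvg => // [z w|x]; [rewrite raddfB|exact: Re_entry_le].
have ic k : cvg ((fun x => complex.Im (entry x k)) @ F).
  by apply: entry_cvg => // [z w|x]; [rewrite raddfB|exact: Im_entry_le].
pose l k : R[i] := lim ((fun x => complex.Re (entry x k)) @ F) +i*
                   lim ((fun x => complex.Im (entry x k)) @ F).
have near_l (x : H) (e : R) : 0 < e -> F (ball x e%:C) ->
    forall n, psum (fun k => entry x k - l k) n <= e ^+ 2.
  move=> e0 Fx n.
  pose g k (y : H) := (complex.Re (entry x k) - complex.Re (entry y k)) ^+ 2 +
                (complex.Im (entry x k) - complex.Im (entry y k)) ^+ 2.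
  have gl k : g k @ F --> sqmod (entry x k - l k).
    rewrite /sqmod !raddfB/=.
    have cr : (fun y : H => complex.Re (entry x k) - complex.Re (entry y k)) @ F -->
      complex.Re (entry x k) - complex.Re (l k).
      by apply: cvgB; [exact: cvg_cst|exact: rc].
    have ci : (fun y : H => complex.Im (entry x k) - complex.Im (entry y k)) @ F -->
      complex.Im (entry x k) - complex.Im (l k).
      by apply: cvgB; [exact: cvg_cst|exact: ic].
    by apply: cvgD; rewrite !expr2; apply: cvgM.
  have gs : (fun y => \sum_(k < n) g k y) @ F --> psum (fun k => entry x k - l k) n.
    by apply: cvg_big => [|k _]; [exact: add_continuous|exact: gl].
  rewrite -(cvg_lim _ gs)//; apply: limr_le; first exact: cvgP gs.
  apply: filterS Fx => y /ell2_ballE /ltW /(enorm_leP _ (ltW e0))/(_ n).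
  congr (_ <= _).
  by apply: eq_bigr => k _; rewrite /sqmod entryD entryN !raddfB.
have ball_ex (e : R) : 0 < e -> exists x : H, F (ball x e%:C).
  by move=> e0; apply: (cauchyP F).1 => //; rewrite ltcR.
have [x1 Fx1] := ball_ex 1 ltr01.
have lx1 : (fun k => entry x1 k - l k) \in @square_summable R.
  by apply/square_summableP; exists (1 ^+ 2) => n; exact: near_l.
have lP : l \in @square_summable R.
  have -> : l = entry (x1 - Ell2 lx1).
    by apply/funext => k; rewrite entryD entryN/= subKr.
  exact: valP.
apply/cvg_ex; exists (Ell2 lP); apply/cvg_ballP => e /pos_complexP[r r0 ->{e}].
have r2 : 0 < r / 2 by rewrite divr_gt0.
have [x Fx] := ball_ex _ r2.
near=> y; apply/ell2_ballE.
rewrite -(subrKA x) (le_lt_trans (enormD _ _))// (splitr r) ler_ltD//.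
  rewrite -opprB -[enorm _]/(complex.Re `|_ : H|) normrN/=.
  by apply/enorm_leP; [exact: ltW|move=> n; exact: near_l].
by near: y; apply: filterS Fx => y /ell2_ballE.
Unshelve. all: by end_near. Qed.

HB.instance Definition _ := Uniform_isComplete.Build H ell2_complete.
End Complete.

(** * The inner product *)

Section InnerProduct.
Variable R : realType.
Implicit Types (x y z : ell2 R) (a : R[i]).

(** This is polarization: each part is a combination of energies, which makes
    it a limit of finite sums; sesquilinearity is inherited from those sums by
    uniqueness of limits. *)
Definition inner x y : R[i] :=
  (energy (entry (x + y)) - energy (entry x) - energy (entry y)) / 2 +i*
  ((energy (entry (x + 'i *: y)) - energy (entry x) - energy (entry ('i *: y))) / 2).

Definition inner_psum x y n : R[i] := \sum_(k < n) entry x k * (entry y k)^*.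

Definition complex_cvg (u : nat -> R[i]) (l : R[i]) :=
  (fun n => complex.Re (u n)) @ \oo --> complex.Re l /\
  (fun n => complex.Im (u n)) @ \oo --> complex.Im l.

Lemma complex_cvg_unique u l l' : complex_cvg u l -> complex_cvg u l' -> l = l'.
Proof.
move=> [ul1 ul2] [ul'1 ul'2]; apply/eqP; rewrite eq_complex.
rewrite -(cvg_lim _ ul1)// -(cvg_lim _ ul2)//.
by rewrite (cvg_lim _ ul'1)// (cvg_lim _ ul'2)// !eqxx.
Qed.

Lemma complex_cvgD u v l l' : complex_cvg u l -> complex_cvg v l' ->
  complex_cvg (fun n => u n + v n) (l + l').
Proof.
move=> [ul1 ul2] [ul'1 ul'2]; split; rewrite raddfD/=.
- by under eq_fun do rewrite raddfD/=; apply: cvgD.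
- by under eq_fun do rewrite raddfD/=; apply: cvgD.
Qed.

Lemma complex_cvgZ a u l : complex_cvg u l ->
  complex_cvg (fun n => a * u n) (a * l).
Proof.
have ReM (z w : R[i]) : complex.Re (z * w) =
  complex.Re z * complex.Re w - complex.Im z * complex.Im w by case: z w => [? ?] [].
have ImM (z w : R[i]) : complex.Im (z * w) =
  complex.Re z * complex.Im w + complex.Im z * complex.Re w by case: z w => [? ?] [].
move=> [ul1 ul2]; split.
- rewrite ReM; under eq_fun do rewrite ReM.
  by apply: cvgB; apply: cvgMr.
- rewrite ImM; under eq_fun do rewrite ImM.
  by apply: cvgD; apply: cvgMr.
Qed.

Lemma complex_cvg_conj u l : complex_cvg u l ->
  complex_cvg (fun n => (u n)^*) (l^*).
Proof.
have ReJ (z : R[i]) : complex.Re z^* = complex.Re z by case: z.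
have ImJ (z : R[i]) : complex.Im z^* = - complex.Im z by case: z.
move=> [ul1 ul2]; split.
- by rewrite ReJ; under eq_fun do rewrite ReJ.
- by rewrite ImJ; under eq_fun do rewrite ImJ; apply: cvgN.
Qed.

Lemma Re_inner_psum x y n : complex.Re (inner_psum x y n) =
  (psum (entry (x + y)) n - psum (entry x) n - psum (entry y) n) / 2.
Proof.
rewrite /inner_psum /psum raddf_sum -!sumrB mulr_suml; apply: eq_bigr => k _.
rewrite entryD; case: (entry x k) (entry y k) => [a b] [c d]; rewrite /sqmod/=.
by field.
Qed.

Lemma Im_inner_psum x y n :
  complex.Im (inner_psum x y n) = complex.Re (inner_psum x ('i *: y) n).
Proof.
rewrite /inner_psum !raddf_sum; apply: eq_bigr => k _.
rewrite entryZ; case: (entry x k) (entry y k) => [a b] [c d] /=.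
by ring.
Qed.

Lemma inner_cvg x y : complex_cvg (inner_psum x y) (inner x y).
Proof.
have reP z : (fun n => (psum (entry (x + z)) n -
        psum (entry x) n - psum (entry z) n) / 2) @ \oo -->
    (energy (entry (x + z)) - energy (entry x) - energy (entry z)) / 2.
  by apply: cvgMl; apply: cvgB; [apply: cvgB|]; exact: psum_cvg.
split.
- by rewrite (funext (Re_inner_psum x y)); exact: reP.
- by rewrite (funext (Im_inner_psum x y)) (funext (Re_inner_psum x _)); exact: reP.
Qed.

Lemma inner_linearl y : linear_for *%R (inner ^~ y).
Proof.
move=> a x x'; apply: (complex_cvg_unique (inner_cvg (a *: x + x') y)).
rewrite (_ : inner_psum _ _ = fun n => a * inner_psum x y n + inner_psum x' y n).
  by apply: complex_cvgD; [apply: complex_cvgZ|]; exact: inner_cvg.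
apply/funext => n; rewrite /inner_psum mulr_sumr -big_split; apply: eq_bigr => k _.
by rewrite entryD entryZ mulrDl mulrA.
Qed.

Lemma inner_conj x y : inner x y = (inner y x)^*.
Proof.
apply: (complex_cvg_unique (inner_cvg x y)).
rewrite (_ : inner_psum _ _ = fun n => (inner_psum y x n)^*).
  by apply: complex_cvg_conj; exact: inner_cvg.
apply/funext => n; rewrite /inner_psum rmorph_sum; apply: eq_bigr => k _ /=.
by rewrite rmorphM/= conjcK mulrC.
Qed.

Lemma inner_linearr x : linear_for (@Num.conj R[i] \; *%R) (inner x).
Proof.
move=> a y y'; rewrite inner_conj inner_linearl rmorphD rmorphM/=.
by rewrite (inner_conj x y) (inner_conj x y').
Qed.

Lemma inner_norm x : `|x| ^+ 2 = inner x x.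
Proof.
apply: complex_cvg_unique (inner_cvg x x).
rewrite ell2_normE -rmorphXn enorm_sqr/=; split => /=.
  rewrite (_ : (fun n => _) = psum (entry x)); first exact: psum_cvg.
  apply/funext => n; rewrite /inner_psum /psum raddf_sum; apply: eq_bigr => k _.
  by case: (entry x k) => a b; rewrite /sqmod/=; ring.
rewrite (_ : (fun n => _) = fun=> 0); first exact: cvg_cst.
apply/funext => n; rewrite /inner_psum raddf_sum big1// => k _.
by case: (entry x k) => a b /=; ring.
Qed.

Lemma inner_gt0 x : x != 0 -> 0 < inner x x.
Proof. by move=> x0; rewrite -inner_norm exprn_gt0// normr_gt0. Qed.

HB.instance Definition _ := bilinear_isBilinear.Build R[i] (ell2 R) (ell2 R) R[i]
  *%R (@Num.conj R[i] \; *%R) inner (inner_linearl, inner_linearr).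

Lemma inner_hermitian x y : inner x y = (-1) ^+ false * Num.conj (inner y x).
Proof. by rewrite expr0 mul1r inner_conj. Qed.

HB.instance Definition _ := isHermitianSesquilinear.Build R[i] (ell2 R)
  false (@Num.conj R[i]) inner inner_hermitian.
HB.instance Definition _ := isDotProduct.Build R[i] (ell2 R) inner inner_gt0.

Lemma ell2_hilbert : is_hilbert (ell2 R).
Proof. by exists inner; exact: inner_norm. Qed.
End InnerProduct.

(** * Roots of unity and their partial geometric sums *)

Section RootsOfUnity.
Variable R : realType.

Definition cis (t : R) : R[i] := cos t +i* sin t.

Lemma cisX t n : cis t ^+ n = cis (n%:R * t).
Proof.
elim: n => [|n IHn]; first by rewrite expr0 mul0r /cis cos0 sin0.
rewrite exprS IHn -natr1 mulrDl mul1r (addrC _ t) /cis cosD sinD.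
by apply/eqP; rewrite eq_complex /= eqxx/= addrC.
Qed.

Lemma sqmod_cis t : sqmod (cis t) = 1.
Proof. exact: cos2Dsin2. Qed.

Definition unity_root (m : nat) : R[i] := cis (2 * pi / m%:R).

Lemma unity_rootX m : (0 < m)%N -> unity_root m ^+ m = 1.
Proof.
move=> m0; rewrite cisX mulrC divfK ?pnatr_eq0 -?lt0n// /cis.
by rewrite mulr_natl cos2pi sin2pi.
Qed.

(** The argument 2 pi / m lies strictly between 0 and pi, so the sine is positive. *)
Lemma unity_root_neq1 m : (2 < m)%N -> unity_root m != 1.
Proof.
move=> m4; rewrite eq_complex /= negb_and; apply/orP; right.
have m0 : 0 < m%:R :> R by rewrite ltr0n; case: m m4.
rewrite gt_eqF// sin_gt0_pi// divr_gt0 ?mulr_gt0 ?pi_gt0//=.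
by rewrite ltr_pdivrMr// mulrC ltr_pM2l ?pi_gt0// ltr_nat.
Qed.

Definition geom (z : R[i]) n : R[i] := \sum_(l < n) z ^+ l.

Lemma geom_unity_root m n : (2 < m)%N -> (m %| n)%N -> geom (unity_root m) n = 0.
Proof.
move=> m4 /dvdnP[q ->]; have m0 : (0 < m)%N by case: m m4.
have := subrX1 (unity_root m) (q * m).
rewrite mulnC exprM unity_rootX// expr1n subrr => /esym/eqP.
by rewrite mulf_eq0 subr_eq0 (negbTE (unity_root_neq1 m4)) => /eqP.
Qed.

Lemma norm_cis t : `|cis t| = 1.
Proof. by rewrite normc_def -[X in Num.sqrt X]/(sqmod _) sqmod_cis sqrtr1. Qed.

Lemma sqmod_geom_le t n : sqmod (geom (cis t) n) <= n%:R ^+ 2.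
Proof.
rewrite -lecR sqmodE rmorphXn/= rmorph_nat lerXn2r ?nnegrE//.
rewrite (le_trans (ler_norm_sum _ _ _))//.
by under eq_bigr do rewrite normrX norm_cis expr1n; rewrite sumr_const card_ord.
Qed.

(** Doubling the angle keeps the cosine nonnegative, so cos t ^ 2 >= 1 / 2, and
    cos t >= cos t ^ 2 since 0 <= cos t <= 1. *)
Lemma cos_ge_half (t : R) : 0 <= t <= pi / 4 -> 2^-1 <= cos t.
Proof.
move=> /andP[t0 t1].
have p0 : 0 < pi :> R by exact: pi_gt0.
have c0 : 0 <= cos t by apply: cos_ge0_pihalf; apply/andP; split; lra.
have c1 := cos_le1 t.
have : 0 <= cos (t + t) by apply: cos_ge0_pihalf; apply/andP; split; lra.
rewrite cosD; have := cos2Dsin2 t; nra.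
Qed.

(** For n at most an eighth of the order, all the summed powers have arguments
    in [0, pi / 4], so each contributes at least 1 / 2 to the real part. *)
Lemma sqmod_geom_ge m n : (8 * n <= m)%N ->
  (n%:R / 2) ^+ 2 <= sqmod (geom (unity_root m) n).
Proof.
move=> nm; have [->|n0] := posnP n; first by rewrite mul0r expr0n sqmod_ge0.
have m0 : 0 < m%:R :> R by rewrite ltr0n; lia.
suff h : n%:R / 2 <= complex.Re (geom (unity_root m) n).
  apply: (@le_trans _ _ (complex.Re (geom (unity_root m) n) ^+ 2)).
    by rewrite lerXn2r ?nnegrE ?(le_trans _ h) ?divr_ge0.
  by rewrite /sqmod lerDl sqr_ge0.
rewrite /geom raddf_sum/= -[n in n%:R]card_ord mulr_natl -sumr_const.
apply: ler_sum => l _; rewrite cisX/=; apply: cos_ge_half.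
have := pi_gt0 R => p0.
apply/andP; split; first by rewrite !(mulr_ge0, divr_ge0) ?ler0n ?(ltW p0).
rewrite mulrA ler_pdivrMr//.
have lm : (8 * l)%:R <= m%:R :> R by rewrite ler_nat; have := ltn_ord l; lia.
have := ler_wpM2l (ltW p0) lm; rewrite natrM.
by move: (nat_of_ord l)%:R m%:R pi => L M p; lra.
Qed.
End RootsOfUnity.

(** * Dense functionals on the plane and lacunary periods *)

(** The forms are the normalized s + q t with q in Q(i), together with t itself,
    which handles the vectors with t = 0.  Only the 2-adic valuation of the index
    selects the form, so each form recurs at arbitrarily large indices. *)
Lemma dense_unit_functionals (R : realType) :
  exists v : nat -> R[i] * R[i],
    (forall k, sqmod (v k).1 + sqmod (v k).2 = 1) /\
    (forall (s t : R[i]) (e : R) (N : nat), 0 < e ->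
      exists2 k, (N <= k)%N & sqmod ((v k).1 * s + (v k).2 * t) <= e).
Proof.
pose q (ab : rat * rat) : R[i] := ratr ab.1 +i* ratr ab.2.
pose len ab : R := Num.sqrt (1 + sqmod (q ab)).
pose u (o : option (rat * rat)) : R[i] * R[i] :=
  if o is Some ab then ((len ab)^-1%:C, (len ab)^-1%:C * q ab) else (0, 1).
have len_gt0 ab : 0 < 1 + sqmod (q ab) by rewrite ltr_wpDr ?sqmod_ge0.
have len2 ab : (len ab)^-1 ^+ 2 = (1 + sqmod (q ab))^-1.
  by rewrite exprVn sqr_sqrtr// ltW.
(* odd factors of k leave the form unchanged, and 3 ^ N pushes k past N *)
exists (fun k => u (odflt None (unpickle (logn 2 k)))); split => [k|s t e N e0].
  case: (odflt _ _) => [ab|] /=; last by rewrite sqmod0 sqmod1 add0r.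
  by rewrite sqmodM sqmodR len2; field; rewrite gt_eqF.
suff: exists c, sqmod ((u c).1 * s + (u c).2 * t) <= e.
  move=> [c cle]; exists (2 ^ pickle c * 3 ^ N)%N.
    apply: (@leq_trans (3 ^ N)); first by rewrite ltnW// ltn_expl.
    by rewrite leq_pmull// expn_gt0.
  by rewrite lognM ?expn_gt0// !lognX muln0 addn0 muln1 pickleK.
have [->|t0] := eqVneq t 0.
  by exists None; rewrite /= mul0r mulr0 addr0 sqmod0 ltW.
have T0 : 0 < sqmod t.
  rewrite lt_neqAle sqmod_ge0 andbT eq_sym.
  by apply: contra t0 => /eqP/sqmod_eq0/eqP.
pose z := - (s / t).
(* r is the tolerance on each part of q - z that leaves a total error of e *)
pose r := Num.sqrt (e / (2 * sqmod t)).
have r20 : 0 < e / (2 * sqmod t) by rewrite divr_gt0// mulr_gt0.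
have r0 : 0 < r by rewrite sqrtr_gt0.
have rat_near (y : R) : exists a : rat, (ratr a - y) ^+ 2 <= r ^+ 2.
  have /rat_in_itvoo[a] : y - r < y + r by lra.
  rewrite in_itv/= => /andP[a1 a2]; exists a.
  by rewrite -subr_ge0 subr_sqr mulr_ge0//; lra.
have [a ha] := rat_near (complex.Re z); have [b hb] := rat_near (complex.Im z).
exists (Some (a, b)) => /=.
have -> : (len (a, b))^-1%:C * s + (len (a, b))^-1%:C * q (a, b) * t =
    (len (a, b))^-1%:C * (t * (q (a, b) - z)).
  by rewrite /z; move: (_%:C) (q _) => l w; field.
rewrite !sqmodM sqmodR len2.
apply: (@le_trans _ _ (sqmod t * sqmod (q (a, b) - z))).
  rewrite ler_piMl ?mulr_ge0 ?sqmod_ge0// invf_le1// lerDl sqmod_ge0//.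
have -> : e = sqmod t * (r ^+ 2 + r ^+ 2).
  by rewrite sqr_sqrtr ?ltW//; field; rewrite gt_eqF.
rewrite ler_pM2l// /sqmod !raddfB/=; exact: lerD.
Qed.

Fixpoint period (i : nat) : nat :=
  if i is j.+1 then (2 ^ i * period j)%N else 1%N.

Lemma period_gt0 i : (0 < period i)%N.
Proof. by elim: i => //= i IH; rewrite muln_gt0 expn_gt0. Qed.

Lemma period_dvd i k : (i <= k)%N -> (period i %| period k)%N.
Proof.
move=> /subnK <-; elim: (k - i)%N => //= l IH.
by rewrite dvdn_mull.
Qed.

Lemma period_lacunary i k : (k < i)%N -> (2 ^ i * period k <= period i)%N.
Proof.
case: i => // i ki; rewrite /= leq_mul2l dvdn_leq ?period_gt0 ?period_dvd//.
by rewrite orbT.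
Qed.

Lemma period_ge i : (2 ^ i <= period i)%N.
Proof. by case: i => //= i; rewrite leq_pmulr// period_gt0. Qed.

(** Take the least j > 2 whose next period is at least 8 n.  By minimality the
    period j is below 8 n, unless j = 3, where period 3 = 64. *)
Lemma period_window n : (0 < n)%N ->
  exists2 j, (2 < j)%N & (period j <= 64 * n)%N && (8 * n <= period j.+1)%N.
Proof.
move=> n0; pose P j := (2 < j)%N && (8 * n <= period j.+1)%N.
have exP : exists j, P j.
  exists (8 * n).+3; apply/andP; split=> //; apply: leq_trans (period_ge _).
  by apply: leq_trans (ltnW (ltn_expl _ _)) => //; lia.
have [j /andP[j2 nj] jmin] := ex_minnP exP; exists j => //; rewrite nj andbT.
have [->|j3] := eqVneq j 3.
  by rewrite [period 3]/= -[X in (X <= _)%N]muln1 leq_mul2l.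
rewrite leqNgt; apply/negP => nj'.
have : P j.-1.
  rewrite /P; have -> : j.-1.+1 = j by lia.
  by apply/andP; split; lia.
by move=> /jmin; lia.
Qed.

(** * Bounded operators and the strong operator topology *)

Section Operators.
Variable R : realType.
Local Notation H := (ell2 R).
Implicit Types (x y : H).

(** Operators are described by their action on entries, so that the estimates
    stay on finite sums. *)
Lemma ell2_operator (F : (nat -> R[i]) -> nat -> R[i]) (M : R) : 0 <= M ->
    (forall a f g j, F (a *: f + g) j = a * F f j + F g j) ->
    (forall x n, psum (F (entry x)) n <= M ^+ 2 * energy (entry x)) ->
  exists T : boundedOp H, forall x j, entry (T x) j = F (entry x) j.
Proof.
move=> M0 Flin FM.
have Fsq x : F (entry x) \in @square_summable R.
  by apply/square_summableP; exists (M ^+ 2 * energy (entry x)); exact: FM.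
pose T0 x := Ell2 (Fsq x).
have T0P : bounded_operators H T0.
  split=> [a x y|]; first by apply: ell2_eq => j; rewrite entryD entryZ /= -Flin.
  exists M%:C => x; rewrite !ell2_normE -rmorphM lecR/=.
  apply/enorm_leP => [|n]; first by rewrite mulr_ge0 ?enorm_ge0.
  by rewrite exprMn enorm_sqr; exact: FM.
by exists (SigSub (mem_set T0P)).
Qed.

(** Evaluation at a vector is continuous for the strong operator topology. *)
Lemma nbhs_eval (A : boundedOp H) x (r : R) : 0 < r ->
  nbhs A [set S : boundedOp H | enorm (A x - S x) < r].
Proof.
move=> r0.
have : {for A, continuous (fun S : boundedOp H => S x)}.
  apply: (@continuous_comp _ _ _
    (set_val : boundedOp H -> {ptws H -> H}) (fun g => g x)).
    exact: initial_continuous.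
  exact: proj_continuous.
move=> /cvgrPdist_lt /(_ r%:C); rewrite ltcR => /(_ r0); apply: filterS => S /=.
by rewrite ell2_normE ltcR.
Qed.
End Operators.

(** The truncation to j >= k is kept inside the sum so that the bound holds
    uniformly over all finite partial sums. *)
Lemma small_tails (R : realType) (h : nat -> R) (M : R) :
    (forall j, 0 <= h j) -> (forall n, \sum_(j < n) h j <= M) ->
  forall e, 0 < e -> exists K, forall k n, (K <= k)%N ->
    \sum_(j < n) (if (k <= j)%N then h j else 0) <= e.
Proof.
move=> h0 hM e e0; pose S n := \sum_(j < n) h j.
have Snd : nondecreasing_seq S.
  by apply/nondecreasing_seqP => n; rewrite /S big_ord_recr/= lerDl.
have Scvg : cvgn S.
  by apply: nondecreasing_is_cvgn => //; exists M => _ [n _ <-]; exact: hM.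
have /cvgrPdist_le/(_ _ e0)[K _ KS] := Scvg.
exists K => k n Kk.
have tail p : \sum_(j < p) (if (k <= j)%N then h j else 0) = S (maxn k p) - S k.
  elim: p => [|p IH]; first by rewrite big_ord0 maxn0 subrr.
  rewrite big_ord_recr/= IH; case: leqP => kp.
    by rewrite (maxn_idPr (leqW kp)) [S p.+1]/S big_ord_recr/= addrAC.
  by rewrite (maxn_idPl kp) addr0.
rewrite tail (le_trans (lerB (nondecreasing_cvgn_le Snd Scvg _) (lexx _)))//.
exact: le_trans (ler_norm _) (KS k Kk).
Qed.

(** * An operator that is not orbit-reflexive *)

Section Example.
Variable R : realType.
Variable v : nat -> R[i] * R[i].
Hypothesis v_unit : forall k, sqmod (v k).1 + sqmod (v k).2 = 1.
Hypothesis v_dense : forall (s t : R[i]) (e : R) (N : nat), 0 < e ->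
  exists2 k, (N <= k)%N & sqmod ((v k).1 * s + (v k).2 * t) <= e.
Implicit Types (x y : ell2 R).

Definition diag j : R[i] :=
  if j is 0 then 0 else if (j < 3)%N then 1 else unity_root R (period j.+1).

(** The coupling w_j (s, t) / m_j, switched off on the first three coordinates
    so that x_1 and x_2 are fixed by the operator. *)
Definition couple j : R[i] -> R[i] -> R[i] := fun s t =>
  if (j < 3)%N then 0 else (period j)%:R^-1 * ((v j).1 * s + (v j).2 * t).

Definition coupled_diag (f : nat -> R[i]) j : R[i] :=
  diag j * f j + couple j (f 1%N) (f 2).

Definition drop0 (f : nat -> R[i]) j : R[i] := (j != 0)%:R * f j.

Lemma couple_linear j a s t s' t' :
  couple j (a * s + s') (a * t + t') = a * couple j s t + couple j s' t'.
Proof. by rewrite /couple; case: ifP => _; [rewrite mulr0 addr0|ring]. Qed.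

Lemma sqmod_functional_le k s t :
  sqmod ((v k).1 * s + (v k).2 * t) <= 2 * (sqmod s + sqmod t).
Proof.
apply: le_trans (sqmodD_le2 _ _) _; rewrite !sqmodM [leRHS]mulrDr.
have := v_unit k; have := sqmod_ge0 (v k).1; have := sqmod_ge0 (v k).2.
move=> ? ? ?.
by apply: lerD; rewrite ler_pM2l// ler_piMl ?sqmod_ge0//; lra.
Qed.

Lemma geometric_sum_le n : \sum_(j < n) (4^-1 : R) ^+ j <= 2.
Proof.
have -> : \sum_(j < n) (4^-1 : R) ^+ j = 4 / 3 * (1 - 4^-1 ^+ n).
  elim: n => [|n IH]; first by rewrite big_ord0 expr0 subrr mulr0.
  by rewrite big_ord_recr/= IH exprS; field.
have : 0 <= (4^-1 : R) ^+ n by rewrite exprn_ge0.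
lra.
Qed.

Lemma invn_sqr_le (a p i : nat) : (0 < a)%N -> (2 ^ i * a <= p)%N ->
  (a%:R : R) ^+ 2 * p%:R^-1 ^+ 2 <= 4^-1 ^+ i.
Proof.
move=> a0 ap.
have p0 : 0 < p%:R :> R by rewrite ltr0n (leq_trans _ ap)// muln_gt0 expn_gt0.
have -> : (4^-1 : R) ^+ i = (2^-1 ^+ i) ^+ 2.
  by rewrite exprAC (_ : 2^-1 ^+ 2 = 4^-1 :> R)//; field.
rewrite -exprMn lerXn2r ?nnegrE ?mulr_ge0 ?exprn_ge0// ?invr_ge0 ?(ltW p0)//.
rewrite ler_pdivrMr// exprVn mulrC ler_pdivlMr ?exprn_gt0// mulrC -natrX -natrM ler_nat//.
Qed.

Lemma sqmod_couple_le j s t : sqmod (couple j s t) <= 2 * (sqmod s + sqmod t) * 4^-1 ^+ j.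
Proof.
rewrite /couple; case: ifP => _.
  by rewrite sqmod0 mulr_ge0 ?exprn_ge0 ?invr_ge0// mulr_ge0// addr_ge0// sqmod_ge0.
rewrite sqmodM sqmod_invn mulrC; apply: ler_pM; rewrite ?sqmod_ge0 ?sqr_ge0//.
  exact: sqmod_functional_le.
have := @invn_sqr_le 1 (period j) j isT; rewrite muln1 expr1n mul1r; apply.
exact: period_ge.
Qed.

Lemma sqmod_diag j : sqmod (diag j) <= 1.
Proof.
rewrite /diag; case: j => [|j]; first by rewrite sqmod0.
case: ifP => _; last by rewrite sqmod_cis.
by rewrite sqmod1.
Qed.

(** Multiplication by diag is a contraction and the coupling has rank two with
    geometrically decaying coefficients.  The energy is multiplied by at most
    2 + 16 = 18, whence the operator bound 5. *)
Lemma coupled_diag_bounded : exists T : boundedOp (ell2 R),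
  forall x j, entry (T x) j = coupled_diag (entry x) j.
Proof.
apply: (@ell2_operator _ _ 5) => // [a f g j|x n].
  have fgE i : (a *: f + g) i = a * f i + g i by [].
  by rewrite /coupled_diag !fgE couple_linear; ring.
set E := energy (entry x).
have E0 : 0 <= E := energy_ge0 x.
apply: (@le_trans _ _ (2 * psum (entry x) n + 2 * (4 * E * 2))); last first.
  by have := psum_le_energy x n; rewrite -/E; lra.
apply: (@le_trans _ _ (2 * psum (entry x) n +
    2 * (4 * E * \sum_(j < n) 4^-1 ^+ j))); last first.
  by rewrite lerD2l ler_pM2l// ler_wpM2l ?mulr_ge0// geometric_sum_le.
rewrite /psum !mulr_sumr -big_split; apply: ler_sum => j _ /=.
apply: le_trans (sqmodD_le2 _ _) _; apply: lerD; rewrite ler_pM2l//.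
  by rewrite sqmodM ler_piMl ?sqmod_ge0 ?sqmod_diag.
apply: le_trans (sqmod_couple_le _ _ _) _; rewrite ler_wpM2r ?exprn_ge0//.
by have := sqmod_entry_le x 1; have := sqmod_entry_le x 2; rewrite -/E; lra.
Qed.

Lemma drop0_bounded : exists A : boundedOp (ell2 R),
  forall x j, entry (A x) j = drop0 (entry x) j.
Proof.
apply: (@ell2_operator _ _ 1) => // [a f g j|x n].
  by rewrite /drop0 -[(a *: f + g) j]/(a * f j + g j); ring.
rewrite expr1n mul1r; apply: le_trans (psum_le_energy x n).
apply: ler_sum => j _; rewrite /drop0; case: eqP => _; last by rewrite mul1r.
by rewrite mul0r sqmod0 sqmod_ge0.
Qed.

Variables T A : boundedOp (ell2 R).
Hypothesis TE : forall x j, entry (T x) j = coupled_diag (entry x) j.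
Hypothesis AE : forall x j, entry (A x) j = drop0 (entry x) j.

(** Entries 1 and 2 are fixed, so each iteration adds the same coupling term,
    rotated by diag j. *)
Lemma entry_iter n x j : entry (iter n T x) j =
  diag j ^+ n * entry x j + geom (diag j) n * couple j (entry x 1%N) (entry x 2).
Proof.
have small n' : (forall j', entry (iter n' T x) j' = diag j' ^+ n' * entry x j' +
    geom (diag j') n' * couple j' (entry x 1%N) (entry x 2)) ->
  (entry (iter n' T x) 1%N = entry x 1%N) /\ (entry (iter n' T x) 2 = entry x 2).
  by move=> E; rewrite !E /couple /diag/= !expr1n !mul1r !mulr0 !addr0.
elim: n j => [|n IH] j; first by rewrite expr0 mul1r /geom big_ord0 mul0r addr0.
have [e1 e2] := small n IH.
rewrite iterS TE /coupled_diag e1 e2 IH /geom big_ord_recl expr0.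
under [in RHS]eq_bigr do rewrite exprS.
by rewrite -mulr_sumr exprS; ring.
Qed.

(** Below k the two vectors agree exactly, since the order period j.+1 of the
    root of unity divides period k.  From k on, the rotation of x_j costs at most
    8 |x_j|^2; the coupling term is geometrically small beyond k, and at k itself
    it is at most the value of the k-th form in modulus. *)
Lemma entry_gap_le x e k j : (2 < k)%N -> 0 <= e ->
    sqmod ((v k).1 * entry x 1%N + (v k).2 * entry x 2) <= e ->
  sqmod (entry (A x - iter (period k) T x) j) <=
    (if (k <= j)%N then 8 * sqmod (entry x j) +
       4 * (sqmod (entry x 1%N) + sqmod (entry x 2)) * 4^-1 ^+ j else 0) +
    (if j == k then 2 * e else 0).
Proof.
move=> k2 e0 ve; set s := entry x 1%N; set t := entry x 2.
have rhs0 : 0 <= (if j == k then 2 * e else 0) by case: ifP => // _; rewrite mulr_ge0.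
rewrite entryD entryN AE entry_iter -/s -/t /drop0.
have [kj|jk] := leqP k j; last first.
  rewrite add0r [X in sqmod X](_ : _ = 0) ?sqmod0//.
  case: j jk rhs0 => [|j] jk _.
    by rewrite /diag /couple/= expr0n gtn_eqF ?period_gt0//= !mul0r mulr0 addr0 subrr.
  rewrite /couple /diag mul1r; case: ltnP => j3.
    by rewrite expr1n mul1r mulr0 addr0 subrr.
  have dk := period_dvd jk.
  have pj : (2 < period j.+2)%N.
    apply: leq_trans (period_ge _).
    by apply: (@leq_trans (2 ^ 2)); rewrite // leq_exp2l.
  rewrite (geom_unity_root _ pj)//.
  rewrite mul0r addr0 -(divnK dk) mulnC exprM unity_rootX ?period_gt0//.
  by rewrite expr1n mul1r subrr.
have j2 : (2 < j)%N := leq_trans k2 kj.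
have -> : (j != 0%N) by case: j j2 {kj rhs0}.
have -> : diag j = cis (2 * pi / (period j.+1)%:R).
  by rewrite /diag ltnNge j2/=; case: j j2 {kj rhs0}.
set d := cis _; set g := geom _ _.
have -> : 1%:R * entry x j - (d ^+ period k * entry x j + g * couple j s t) =
   (1 - d ^+ period k) * entry x j + - g * couple j s t by ring.
apply: le_trans (sqmodD_le2 _ _) _.
rewrite !sqmodM sqmodN -addrA; apply: lerD.
  have d4 : sqmod (1 - d ^+ period k) <= 4.
    apply: le_trans (sqmodD_le2 _ _) _.
    by rewrite sqmodN sqmodX sqmod_cis expr1n sqmod1; lra.
  by rewrite mulrA ler_wpM2r ?sqmod_ge0//; lra.
have gk : sqmod g <= (period k)%:R ^+ 2 by exact: sqmod_geom_le.
rewrite /couple ltnNge j2/= sqmodM sqmod_invn.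
have [jk|jk] := eqVneq j k.
  rewrite -jk in ve gk *; apply: (@le_trans _ _ (2 * e)); last first.
    by rewrite lerDr !mulr_ge0 ?exprn_ge0 ?invr_ge0// addr_ge0 ?sqmod_ge0.
  rewrite ler_pM2l// mulrA; apply: le_trans ve; rewrite ler_piMl ?sqmod_ge0//.
  rewrite (le_trans (ler_wpM2r _ gk)) ?sqr_ge0//.
  by rewrite -exprMn divff ?expr1n// pnatr_eq0 -lt0n period_gt0.
have {}jk : (k < j)%N by rewrite ltn_neqAle eq_sym jk.
have -> : 4 * (sqmod s + sqmod t) * 4^-1 ^+ j + 0 =
    2 * (4^-1 ^+ j * (2 * (sqmod s + sqmod t))) by ring.
rewrite ler_pM2l// mulrA.
apply: ler_pM; rewrite ?sqmod_ge0 ?mulr_ge0 ?sqr_ge0 ?sqmod_ge0//; last first.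
  exact: sqmod_functional_le.
apply: le_trans (ler_wpM2r _ gk) _; first exact: sqr_ge0.
by apply: invn_sqr_le; rewrite ?period_gt0// period_lacunary.
Qed.

(** Along the indices k at which the k-th form nearly vanishes at (x_1, x_2), the
    iterates of order period k approach A x. *)
Lemma drop0_in_orbit_closure x : closure (Orb x T) (A x).
Proof.
move=> B /nbhs_ballP[_ /pos_complexP[r r0 ->] rB].
set C := sqmod (entry x 1%N) + sqmod (entry x 2).
have C0 : 0 <= C by rewrite addr_ge0 ?sqmod_ge0.
pose h j := 8 * sqmod (entry x j) + 4 * C * 4^-1 ^+ j.
have h0 j : 0 <= h j.
  by rewrite addr_ge0 ?mulr_ge0 ?sqmod_ge0 ?exprn_ge0 ?invr_ge0.
have hM n : \sum_(j < n) h j <= 8 * energy (entry x) + 4 * C * 2.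
  rewrite big_split/= -!mulr_sumr; apply: lerD.
    by rewrite ler_pM2l//; exact: psum_le_energy.
  by rewrite ler_wpM2l ?mulr_ge0// geometric_sum_le.
(* the tail accounts for e and the single coordinate k for 2 e *)
pose e := (r / 2) ^+ 2 / 3.
have e0 : 0 < e by rewrite divr_gt0// exprn_gt0// divr_gt0.
have [K hK] := small_tails h0 hM e0.
have [k kK ve] := v_dense (entry x 1%N) (entry x 2) (maxn K 3) e0.
have [Kk k2] : (K <= k)%N /\ (2 < k)%N by move: kK; rewrite geq_max => /andP[].
exists (iter (period k) T x); split; first by exists (period k).
apply: rB; apply/ell2_ballE; apply: (@le_lt_trans _ _ (r / 2)); last by lra.
apply/enorm_leP => [|n]; first by lra.
rewrite (_ : (r / 2) ^+ 2 = e + 2 * e); last by rewrite /e; field.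
have single p : \sum_(j < p) (if j == k :> nat then 2 * e else 0) =
    if (k < p)%N then 2 * e else 0.
  elim: p => [|p IH]; first by rewrite big_ord0.
  rewrite big_ord_recr/= IH ltnS (leq_eqVlt k) eq_sym.
  by case: ltngtP; rewrite ?add0r ?addr0.
apply: (@le_trans _ _ (\sum_(j < n) ((if (k <= j)%N then h j else 0) +
    (if j == k :> nat then 2 * e else 0)))).
  by apply: ler_sum => j _; apply: entry_gap_le => //; exact: ltW.
rewrite big_split/=; apply: lerD; first exact: hK.
by rewrite single; case: ifP => // _; rewrite mulr_ge0// ltW.
Qed.

(** For n = 0 the basis vector e_0 is fixed by the identity but killed by A.
    For n > 0 the coordinate j provided by [period_window] of T^n e_1 or T^n e_2
    is at least 1 / 128 times the modulus of a coefficient of the j-th form, and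
    one of the two squared moduli is at least 1 / 2. *)
Lemma drop0_gap n :
  exists2 i, (i < 3)%N &
    256^-1 <= enorm (A (unit_vec R i) - iter n T (unit_vec R i)).
Proof.
have enorm_ge x j (c : R) : 0 <= c -> c ^+ 2 <= sqmod (entry x j) -> c <= enorm x.
  move=> c0 cj; rewrite -(@ler_pXn2r _ 2) ?nnegrE ?enorm_ge0//.
  by rewrite (le_trans cj)// enorm_sqr sqmod_entry_le.
have [->|n0] := posnP n.
  exists 0%N => //; apply: (enorm_ge _ 0%N); first by rewrite invr_ge0.
  rewrite entryD entryN AE /drop0/= mul0r add0r /sqmod/= !expr2; lra.
have [j j2 /andP[jn nj]] := period_window n0.
have val i : (i < 3)%N -> entry (A (unit_vec R i) - iter n T (unit_vec R i)) j =
    - (geom (unity_root R (period j.+1)) n *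
       ((period j)%:R^-1 * ((v j).1 * delta R i 1 + (v j).2 * delta R i 2))).
  move=> i3; rewrite entryD entryN AE entry_iter /drop0 /couple ltnNge j2 /=.
  rewrite {1 2}/delta (_ : (i == j) = false) ?mulr0 ?add0r; last by apply/eqP; lia.
  by rewrite /diag ltnNge j2/=; case: (j) j2.
have lower i w : (i < 3)%N -> 2^-1 <= sqmod w ->
    (v j).1 * delta R i 1 + (v j).2 * delta R i 2 = w ->
    256^-1 <= enorm (A (unit_vec R i) - iter n T (unit_vec R i)).
  move=> i3 w2 wE; apply: (enorm_ge _ j); first by rewrite invr_ge0.
  rewrite val// wE sqmodN !sqmodM sqmod_invn.
  have P0 : 0 < (period j)%:R :> R by rewrite ltr0n period_gt0.
  have nP : 128^-1 <= n%:R / 2 * (period j)%:R^-1 :> R.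
    rewrite ler_pdivlMr//; have : (period j)%:R <= (64 * n)%:R :> R by rewrite ler_nat.
    by rewrite natrM; lra.
  have nP2 : 128^-1 ^+ 2 <= (n%:R / 2 * (period j)%:R^-1) ^+ 2 :> R.
    by rewrite lerXn2r ?nnegrE ?invr_ge0// (le_trans _ nP)// invr_ge0.
  have gn : (n%:R / 2 * (period j)%:R^-1) ^+ 2 <=
      sqmod (geom (unity_root R (period j.+1)) n) * (period j)%:R^-1 ^+ 2.
    by rewrite exprMn ler_wpM2r ?sqr_ge0// sqmod_geom_ge.
  rewrite mulrA; apply: (@le_trans _ _ (128^-1 ^+ 2 * 2^-1)).
    by rewrite !expr2; lra.
  by apply: ler_pM => //; rewrite ?sqr_ge0 ?invr_ge0//; exact: le_trans nP2 gn.
have [v1|v1] := lerP 2^-1 (sqmod (v j).1).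
  by exists 1%N => //; apply: lower v1 _ => //; rewrite /delta/= mulr1 mulr0 addr0.
have v2 : 2^-1 <= sqmod (v j).2 by have := v_unit j; lra.
by exists 2 => //; apply: lower v2 _ => //; rewrite /delta/= mulr1 mulr0 add0r.
Qed.

Lemma drop0_notin_powers_closure : ~ closure (powers T) A.
Proof.
have N i := @nbhs_eval R A (unit_vec R i) 256^-1.
have r0 : 0 < 256^-1 :> R by rewrite invr_gt0.
move=> /(_ _ (filterI (N 0 r0) (filterI (N 1 r0) (N 2 r0)))).
move=> [S [[n Sn] [/= S0 [/= S1 S2]]]].
move: S0 S1 S2; rewrite !Sn => S0 S1 S2.
have [i i3] := drop0_gap n; rewrite leNgt => /negP; apply.
by case: i i3 => [|[|[|]]].
Qed.
End Example.

Theorem theorem1p5 (R : realType) :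
  exists H : completeNormedModType R[i],
    is_hilbert H /\ exists T : boundedOp H, ~ orbit_reflexive T.
Proof.
exists (ell2 R); split; first exact: ell2_hilbert.
have [v [v_unit v_dense]] := dense_unit_functionals R.
have [T TE] := coupled_diag_bounded v_unit; have [A AE] := drop0_bounded R.
exists T => reflexive_T; apply: (drop0_notin_powers_closure v_unit TE AE).
apply: reflexive_T => x.
have := @drop0_in_orbit_closure R v v_unit v_dense T A TE AE x; exact.
Qed.
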